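(* Let $S$ be an $\mathbb{N}^p$-semigroup with embedding dimension $2p$. Then there exist $i\in \{1,\ldots,p\}$, $\lambda_1,\lambda_2\in \mathbb{N}$ with $\gcd(\lambda_1,\lambda_2)=1$, and $\{q_j\}_{j\in \{1,\ldots,p\}\setminus \{i\}}\subset \mathbb{N}$ such that $$\{e_1,\ldots ,e_{i-1},e_{i+1},\ldots ,e_p,\lambda_1 e_i,\lambda_2 e_i\}\cup \{e_i+q_je_j \mid j\in \{1,\ldots,p\}\setminus \{i\}\}$$ is the minimal generating set of $S$.
   Context: $\mathbb{N}$ is the set of nonnegative integers, $p$ is a positive integer and $\{e_1,\ldots,e_p\}$ is the standard basis of $\mathbb{N}^p$. An affine semigroup is a finitely generated submonoid of $(\mathbb{N}^p,+)$; it has a unique minimal generating set (as a monoid), whose cardinality is called its embedding dimension. An $\mathbb{N}^p$-semigroup is an affine semigroup $S\subset\mathbb{N}^p$ such that $\mathbb{N}^p\setminus S$ is finite. *)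

(* Defs.v *)
From mathcomp Require Import all_boot all_algebra.
From mathcomp Require Import classical_sets cardinality.
Set Implicit Arguments.
Unset Strict Implicit.
Unset Printing Implicit Defensive.

Import GRing.Theory.
Local Open Scope classical_set_scope.
Local Open Scope card_scope.
Local Open Scope ring_scope.

(* The monoid N^p is the type 'rV[nat]_p with its entrywise addition. *)
Definition std_basis (p : nat) (j : 'I_p) : 'rV[nat]_p := delta_mx 0 j.

Definition submonoid (p : nat) (M : set 'rV[nat]_p) : Prop :=
  Algebra.nmod_closed (mem M).

Definition monoid_span (p : nat) (A : set 'rV[nat]_p) : set 'rV[nat]_p :=
  smallest (@submonoid p) A.

Definition affine_semigroup (p : nat) (S : set 'rV[nat]_p) : Prop :=
  exists2 A : set 'rV[nat]_p, finite_set A & monoid_span A = S.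

Definition minimal_generating_set (p : nat) (S A : set 'rV[nat]_p) : Prop :=
  monoid_span A = S /\
  forall B : set 'rV[nat]_p, B `<=` A -> monoid_span B = S -> B = A.

(* Relational form: every affine semigroup has exactly one minimal generating
   set, hence exactly one embedding dimension. *)
Definition has_embedding_dimension (p : nat) (S : set 'rV[nat]_p) (n : nat) :
    Prop :=
  exists2 A : set 'rV[nat]_p, minimal_generating_set S A & A #= `I_n.

Definition Np_semigroup (p : nat) (S : set 'rV[nat]_p) : Prop :=
  affine_semigroup S /\ finite_set (~` S).

(* Main.v *)
(** Some [std_basis i] is missing from [S], since otherwise [S] is all of [N^p],
    which has only [p] minimal generators. Cofiniteness forces two minimal
    generators on the [i]-axis, one on every other axis, and one of the form
    [std_basis i + std_basis j *+ q j] for every [j != i]. These are [2p]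
    distinct vectors, hence all the minimal generators, and cofiniteness on each
    axis gives [gcdn l1 l2 = 1] and that the generator on the [j]-axis is
    [std_basis j]. *)
Require Import Defs.
From mathcomp Require Import all_boot all_algebra.
From mathcomp Require Import classical_sets cardinality.
From mathcomp Require Import finmap boolp zify.
Import GRing.Theory.
Local Open Scope classical_set_scope.
Local Open Scope ring_scope.

(** * Coordinates and vectors on the axes *)

Lemma std_basis_mulrnE {p : nat} (j k : 'I_p) (n : nat) :
  (std_basis j *+ n) 0 k = if k == j then n else 0%N.
Proof.
rewrite mulmxnE mxE eqxx /=; case: (k == j) => /=; last by rewrite mul0rn.
by elim: n => // n IHn; rewrite mulrS IHn.
Qed.

Lemma addrowE {p : nat} (v w : 'rV[nat]_p) (k : 'I_p) :
  (v + w) 0 k = (v 0%R k + w 0%R k)%N.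
Proof. by rewrite mxE. Qed.

Definition on_axis {p : nat} (j : 'I_p) (v : 'rV[nat]_p) : Prop :=
  forall k, k != j -> v 0%R k = 0%N.

Lemma on_axisP {p : nat} (j : 'I_p) (v : 'rV[nat]_p) :
  on_axis j v -> v = std_basis j *+ v 0%R j.
Proof.
move=> v_j; apply/rowP => k; rewrite std_basis_mulrnE.
by case: eqVneq => [->|/v_j].
Qed.

Lemma on_axis_mulrn {p : nat} (j : 'I_p) (n : nat) :
  on_axis j (std_basis j *+ n).
Proof. by move=> k /negPf kj; rewrite std_basis_mulrnE kj. Qed.

(** * Spans and irreducible elements *)

Lemma submonoidP {p : nat} (M : set 'rV[nat]_p) :
  submonoid M <-> M 0 /\ forall x y, M x -> M y -> M (x + y).
Proof.
split=> [[M0 MD]|[M0 MD]].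
  split=> [|x y Mx My]; first exact: set_mem.
  by apply: set_mem; apply: MD; apply: mem_set.
split=> [|x y Mx My]; first exact: mem_set.
by apply: mem_set; apply: MD; apply: set_mem.
Qed.

Lemma submonoid_span {p : nat} (A : set 'rV[nat]_p) :
  submonoid (monoid_span A).
Proof.
apply/submonoidP; split=> [M [/submonoidP[]]//|x y Ax Ay M AM].
by have [/submonoidP[_ MD] _] := AM; apply: MD; [apply: Ax|apply: Ay].
Qed.

Lemma subset_span {p : nat} (A : set 'rV[nat]_p) : A `<=` monoid_span A.
Proof. exact: sub_gen_smallest. Qed.

(** If [x] were not in [A], removing it from the span would leave a submonoid, by irreducibility,
    that still contains [A], hence the whole span. *)
Lemma irreducible_generator {p : nat} (A : set 'rV[nat]_p) (x : 'rV[nat]_p) :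
  monoid_span A x -> x != 0 ->
  (forall a b, monoid_span A a -> monoid_span A b -> x = a + b ->
     a = 0 \/ b = 0) ->
  A x.
Proof.
move=> Sx x0 irr; apply: contrapT => Ax.
have /submonoidP[S0 SD] := submonoid_span A.
suff /(_ x Sx)[] : monoid_span A `<=` [set v | monoid_span A v /\ v <> x] by [].
apply: smallest_sub; last first.
  by move=> v Av; split; [exact: subset_span|move=> vx; rewrite -vx in Ax].
apply/submonoidP; split; first by split=> // e; rewrite -e eqxx in x0.
move=> a b [Sa ax] [Sb bx]; split; first exact: SD.
move=> e; case: (irr a b Sa Sb (esym e)) => z; move: e; rewrite z ?add0r ?addr0.
  by move/bx.
by move/ax.
Qed.

(** * Elements that every generating set must contain *)

Lemma cofinite_large_entry {p : nat} (S : set 'rV[nat]_p) (k : 'I_p) :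
  finite_set (~` S) -> exists N, forall v : 'rV[nat]_p, (N <= v 0%R k)%N -> S v.
Proof.
move=> /finite_seqP[s sE].
exists (\max_(v <- s) v 0%R k).+1 => v; apply: contraTP => Sv.
have vs : v \in s by have : (~` S) v by []; rewrite sE.
by rewrite -leqNgt (big_rem v) //= leq_maxl.
Qed.

(* Otherwise every point of the [j]-axis in the monoid would be a multiple of
   [d], although two consecutive multiples of [std_basis j] lie in it. *)
Lemma axis_generator {p : nat} (S A : set 'rV[nat]_p) (j : 'I_p) (d : nat) :
  finite_set (~` S) -> monoid_span A = S -> d != 1%N ->
  exists2 n, A (std_basis j *+ n) & ~~ (d %| n)%N.
Proof.
move=> finS AS d1; apply: contrapT => noA.
have ST : S `<=` [set v | on_axis j v -> (d %| v 0%R j)%N].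
  rewrite -AS; apply: smallest_sub; last first.
    move=> v Av vj; apply: contrapT => /negP dv; apply: noA.
    by exists (v 0%R j); rewrite -?on_axisP.
  apply/submonoidP; split=> [_|v w Tv Tw vw]; first by rewrite mxE.
  (* Entries are nonnegative, so both summands of a vector on the axis lie on it. *)
  rewrite addrowE dvdn_add //; [apply: Tv|apply: Tw] => k /vw;
    by rewrite addrowE => /eqP; rewrite addn_eq0 => /andP[/eqP ? /eqP].
have [N SN] := cofinite_large_entry S j finS.
have dN n : (N <= n)%N -> (d %| n)%N.
  move=> Nn; have := ST (std_basis j *+ n); rewrite /= std_basis_mulrnE eqxx.
  apply; last exact: on_axis_mulrn.
  by apply: SN; rewrite std_basis_mulrnE eqxx.
by move: d1; rewrite -dvdn1 -(dvdn_addr 1 (dN N _)) // addn1 dN.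
Qed.

Lemma std_basis_neq0 {p : nat} (j : 'I_p) : std_basis j != 0.
Proof.
apply/eqP => /rowP/(_ j); rewrite -[std_basis j]mulr1n std_basis_mulrnE eqxx.
by rewrite mxE.
Qed.

Lemma std_basis_generator {p : nat} (A : set 'rV[nat]_p) (j : 'I_p) :
  monoid_span A (std_basis j) -> A (std_basis j).
Proof.
move=> Sj; apply: irreducible_generator => // [|a b _ _ e].
  exact: std_basis_neq0.
have ek k : (a 0%R k + b 0%R k)%N = if k == j then 1%N else 0%N.
  by rewrite -addrowE -e -[std_basis j]mulr1n std_basis_mulrnE.
have zero (v : 'rV[nat]_p) : (forall k, v 0%R k <= a 0%R k + b 0%R k)%N ->
    v 0%R j = 0%N -> v = 0.
  move=> le v0; apply/rowP => k; rewrite mxE; apply/eqP; rewrite -leqn0.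
  have := le k; rewrite ek; case: eqVneq => // -> _; by rewrite v0.
have := ek j; rewrite eqxx => ej.
have [a0|a0] := eqVneq (a 0%R j) 0%N; [left|right]; apply: zero => //; move=> *; lia.
Qed.

(* With [q] least such that [std_basis i + std_basis j *+ q] is in the monoid,
   this vector is irreducible: the summand carrying the unit [i]-entry has to be
   the whole of it. *)
Lemma mixed_generator {p : nat} (S A : set 'rV[nat]_p) (i j : 'I_p) :
  finite_set (~` S) -> monoid_span A = S -> ~ S (std_basis i) -> j != i ->
  exists2 q, (0 < q)%N & A (std_basis i + std_basis j *+ q).
Proof.
move=> finS AS Si ji.
have cE q k : (std_basis i + std_basis j *+ q) 0 k =
    if k == i then 1%N else if k == j then q else 0%N.
  rewrite addrowE -[std_basis i]mulr1n !std_basis_mulrnE.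
  by case: (eqVneq k i) => // ->; rewrite eq_sym (negPf ji).
have ex : exists q, `[< S (std_basis i + std_basis j *+ q) >].
  have [N SN] := cofinite_large_entry S j finS.
  by exists N; apply/asboolP/SN; rewrite cE eqxx (negPf ji).
case: (ex_minnP ex) => q /asboolP Sq qmin; exists q.
  (* For [q = 0] the vector would be [std_basis i], which is not in [S]. *)
  by case: q Sq {qmin} => //; rewrite mulr0n addr0.
have irr a b : S a -> S b -> std_basis i + std_basis j *+ q = a + b ->
    b 0%R i = 0%N -> b = 0.
  move=> Sa Sb e bi0.
  have ek k : (a 0%R k + b 0%R k)%N =
      if k == i then 1%N else if k == j then q else 0%N.
    by rewrite -addrowE -e cE.
  (* The summand [a] has the same shape with its own [j]-th entry in place of [q]; minimality of [q]
     then leaves nothing for [b]. *)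
  have aE : a = std_basis i + std_basis j *+ a 0%R j.
    apply/rowP => k; rewrite cE; move: (ek k).
    case: eqVneq => [->|_]; first by rewrite bi0 addn0.
    by case: eqVneq => [->//|_]; lia.
  have /qmin qa : `[< S (std_basis i + std_basis j *+ a 0%R j) >].
    by apply/asboolP; rewrite -aE.
  apply/rowP => k; rewrite mxE; move: (ek k).
  case: eqVneq => [->//|_]; case: eqVneq => [->|_]; lia.
apply: irreducible_generator; rewrite ?AS //.
  by apply/eqP => /rowP/(_ i); rewrite cE eqxx mxE.
move=> a b Sa Sb e; have := cE q i; rewrite eqxx e addrowE => ei.
have [b0|b0] := eqVneq (b 0%R i) 0%N; first by right; apply: irr e b0.
by left; apply: (irr b a Sb Sa); [rewrite [b + a]addrC|lia].
Qed.

(** * Counting generators *)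

Lemma card_eq_uniq_seq {T : choiceType} (A : set T) (n : nat) :
  (A #= `I_n)%card ->
  exists s : seq T, [/\ uniq s, size s = n & A = [set` s]].
Proof.
move=> An; have /finite_fsetP[X XE] : finite_set A by apply/finite_setP; exists n.
exists (enum_fset X); split=> //.
by apply/card_eq_fsetP; rewrite -XE.
Qed.

Lemma card_eq_range {I : finType} {T : choiceType} (A : set T) (f : I -> T) :
  (A #= `I_#|I|)%card -> injective f -> range f `<=` A -> range f = A.
Proof.
move=> /card_eq_uniq_seq[s [us sn ->]] f_inj fs.
have sub : {subset map f (enum I) <= s}.
  by move=> _ /mapP[x _ ->]; apply: fs; exists x.
have um : uniq (map f (enum I)) by rewrite map_inj_uniq ?enum_uniq.
have [|_ eqs] := uniq_min_size um sub; first by rewrite size_map -cardE sn.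
apply/seteqP; split=> // x xs; have : x \in map f (enum I) by rewrite eqs.
by move=> /mapP[y _ ->]; exists y.
Qed.

Lemma exists_missing_std_basis {p : nat} (S : set 'rV[nat]_p) :
  (0 < p)%N -> has_embedding_dimension S (2 * p)%N ->
  exists i : 'I_p, ~ S (std_basis i).
Proof.
move=> p0 [A [AS Amin] /card_eq_uniq_seq[s [us ss sE]]].
apply: contrapT => allS.
have Sj j : S (std_basis j) by apply: contrapT => Sj; apply: allS; exists j.
have EA : range (@std_basis p) `<=` A.
  by move=> _ [j _ <-]; apply: std_basis_generator; rewrite AS.
have ES : monoid_span (range (@std_basis p)) = S.
  apply/seteqP; split=> [|v _].
    by rewrite -AS; apply: sub_smallest2r => //; exact: submonoid_span.
  have /submonoidP[E0 ED] := submonoid_span (range (@std_basis p)).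
  have -> : v = \sum_j std_basis j *+ v 0%R j.
    apply/rowP => k; rewrite summxE (bigD1 k) //= big1 => [|j /negPf jk].
      by rewrite std_basis_mulrnE eqxx addr0.
    by rewrite std_basis_mulrnE eq_sym jk.
  apply: big_ind => // j _; elim: (v 0%R j) => [|n IHn]; first by rewrite mulr0n.
  by rewrite mulrS; apply: ED => //; apply: subset_span; exists j.
(* Minimality makes [A] the set of basis vectors, so [2 * p <= p], against [0 < p]. *)
have sub : {subset s <= map (@std_basis p) (enum 'I_p)}.
  move=> v vs; have : A v by rewrite sE.
  by rewrite -(Amin _ EA ES) => -[j _ <-]; rewrite map_f ?mem_enum.
have := uniq_leq_size us sub; rewrite size_map size_enum_ord ss; lia.
Qed.

Theorem proposition5 (p : nat) (hp : (0 < p)%N) (S : set 'rV[nat]_p)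
    (hS : Np_semigroup S) (hdim : has_embedding_dimension S (2 * p)%N) :
  exists (i : 'I_p) (l1 l2 : nat) (q : 'I_p -> nat),
    gcdn l1 l2 = 1%N /\
    minimal_generating_set S
      ([set std_basis j | j in [set j : 'I_p | j != i]]
       `|` [set std_basis i *+ l1; std_basis i *+ l2]
       `|` [set std_basis i + std_basis j *+ q j
             | j in [set j : 'I_p | j != i]]).
Proof.
have [i Si] := exists_missing_std_basis S hp hdim.
have [_ finS] := hS; have [A Amin Acard] := hdim; have [AS _] := Amin.
have axis j d := axis_generator S A j d finS AS.
(* Non-divisibility by [0] means that [l1] is nonzero. Taking [d = l1] next gives an [l2] that is
   neither [0] nor [l1]. *)
have [l1 Al1 dl1] := axis i 0%N isT.
have l1_neq1 : l1 != 1%N.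
  apply/eqP => l11; apply: Si; rewrite -AS; apply: subset_span.
  by rewrite l11 mulr1n in Al1.
have [l2 Al2 dl2] := axis i l1 l1_neq1.
have /choice[m mP] : forall j, exists n, A (std_basis j *+ n) /\ n != 0%N.
  by move=> j; have [n An dn] := axis j 0%N isT; exists n; rewrite -dvd0n.
have /choice[q qP] : forall j, exists q, j != i ->
    (0 < q)%N /\ A (std_basis i + std_basis j *+ q).
  move=> j; have [->|ji] := eqVneq j i; first by exists 0%N.
  by have [q] := mixed_generator S A i j finS AS Si ji; exists q.
(* The candidates are indexed by two copies of ['I_p]: one vector on each axis, then the mixed
   vectors, with the free slot [i] holding the second vector on the [i]-axis. *)
pose f (x : 'I_p + 'I_p) := match x with
  | inl j => std_basis j *+ (if j == i then l1 else m j)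
  | inr j => if j == i then std_basis i *+ l2
             else std_basis i + std_basis j *+ q j
  end.
have cE j k : (std_basis i + std_basis j *+ q j) 0 k =
    ((k == i) + (if k == j then q j else 0))%N.
  rewrite addrowE -[std_basis i]mulr1n !std_basis_mulrnE.
  by case: (k == i).
have fA : range f `<=` A.
  move=> _ [[j|j] _ <-]; rewrite /f; have [ji|ji] := eqVneq j i => //.
  - by rewrite ji.
  - by have [] := mP j.
  - by have [] := qP j ji.
have l1_neq0 : l1 != 0%N by rewrite -dvd0n.
have l1_neq_l2 : l1 != l2 by apply: contraNneq dl2 => ->.
have n_neq0 j : (if j == i then l1 else m j) != 0%N.
  by case: (j == i) => //; have [] := mP j.
have inl_inr j k : f (inl j) <> f (inr k).
  (* The [i]-th entry is [l1] or [0] on the left, [l2] or [1] on the right. *)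
  move=> /rowP/(_ i); rewrite /f std_basis_mulrnE (eq_sym i).
  have [_|ki] := eqVneq k i; rewrite ?cE ?std_basis_mulrnE eqxx.
    by case: (j == i) => [|l20]; [exact/eqP|rewrite -l20 dvdn0 in dl2].
  rewrite (eq_sym i k) (negPf ki) addn0.
  by case: (j == i) => //; exact/eqP.
have f_inj : injective f.
  move=> [j|j] [k|k] e; [congr inl| |symmetry in e|congr inr];
    try by case: (inl_inr _ _ e).
    move: e => /rowP/(_ j); rewrite /f !std_basis_mulrnE eqxx.
    by have [//|_ /eqP] := eqVneq j k; rewrite (negPf (n_neq0 j)).
  (* For [j != i], only [f (inr j)] among the right values has a nonzero [j]-th entry, namely
     [q j]. *)
  move: e => /rowP e; move: (e j) (e k); rewrite /f.
  have [-> |ji] := eqVneq j i; have [-> //|ki] := eqVneq k i.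
  - rewrite !cE !std_basis_mulrnE !eqxx (negPf ki) => _.
    by have [] := qP k ki; case: (q k).
  - rewrite !cE !std_basis_mulrnE !eqxx (negPf ji).
    by have [] := qP j ji; case: (q j).
  - rewrite !cE !eqxx (negPf ji); have [//|_] := eqVneq j k.
    by have [] := qP j ji; case: (q j).
have fE : range f = A.
  apply: card_eq_range => //; by rewrite card_sum card_ord addnn -mul2n.
(* Since [A] is the range of [f], its elements on each axis can be read off: a mixed vector lies on
   no axis, because [q k] is positive. *)
have axisA j n : A (std_basis j *+ n) -> (n != 0)%N ->
    (j != i /\ n = m j) \/ (j = i /\ (n = l1 \/ n = l2)).
  rewrite -fE => -[[k|k] _ /rowP e] n0.
    move: (e j); rewrite /f !std_basis_mulrnE eqxx.
    case: (eqVneq j k) => [<-|_ n0']; last by rewrite -n0' in n0.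
    by case: eqVneq => [ji <-|ji <-]; [right; split=> //; left|left].
  move: (e); rewrite /f; case: (eqVneq k i) => [_|ki] {}e.
    move: (e j); rewrite !std_basis_mulrnE eqxx.
    case: (eqVneq j i) => [-> <-|_ n0']; last by rewrite -n0' in n0.
    by right; split=> //; right.
  have [qk _] := qP k ki.
  move: (e i) (e k); rewrite !cE !std_basis_mulrnE !eqxx (eq_sym i k) (negPf ki).
  case: (eqVneq i j) => // <-; rewrite (negPf ki) => _ qk0.
  by rewrite add0n in qk0; rewrite qk0 in qk.
have m1 j : j != i -> m j = 1%N.
  (* Otherwise [axis] with [d = m j] gives a generator on the [j]-axis other than [m j], the only
     one there. *)
  move=> ji; apply: contrapT => /eqP /(axis j)[n An dn].
  have n0 : n != 0%N by apply: contraNneq dn => ->.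
  have [[_ nm]|[ji' _]] := axisA j n An n0; first by rewrite nm dvdnn in dn.
  by rewrite ji' eqxx in ji.
exists i, l1, l2, q; split.
  (* Both generators on the [i]-axis are multiples of the gcd, so [axis] with [d = gcdn l1 l2]
     forces it to be [1]. *)
  apply: contrapT => /eqP /(axis i)[n An dn].
  have n0 : n != 0%N by apply: contraNneq dn => ->.
  have [[]|[_ [] nl]] := axisA i n An n0; first by rewrite eqxx.
    by rewrite nl dvdn_gcdl in dn.
  by rewrite nl dvdn_gcdr in dn.
set G := (G in minimal_generating_set S G); suff -> : G = A by [].
rewrite -fE; apply/seteqP; split.
  move=> v [[[j /= ji <-]|[->|->]]|[j /= ji <-]].
  - by exists (inl j) => //; rewrite /f (negPf ji) m1.
  - by exists (inl i) => //; rewrite /f eqxx.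
  - by exists (inr i) => //; rewrite /f eqxx.
  - by exists (inr j) => //; rewrite /f (negPf ji).
move=> _ [[j|j] _ <-]; rewrite /f; have [ji|ji] := eqVneq j i.
- by rewrite ji; left; right; left.
- by left; left; exists j; rewrite // m1.
- by left; right; right.
- by right; exists j.
Qed.
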